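(* Let $G$ be a connected graph of maximum degree $\Delta\ge 1$, and let every vertex $v\in V(G)$ be assigned a list $L(v)$ of $2\Delta$ colors. Then $G$ admits an odd coloring $\varphi$ with $\varphi(v)\in L(v)$ for every $v\in V(G)$, unless $G$ is the cycle $C_5$ and all lists are identical.
   Context: All graphs are finite, simple and undirected. A proper vertex coloring $\varphi$ of a graph $G$ is called an odd coloring if for every non-isolated vertex $x$ of $G$ there is a color $c$ such that the number of neighbors $y\in N(x)$ with $\varphi(y)=c$ is odd. *)

(* Defs.v *)
From mathcomp Require Import all_boot finmap.

Set Implicit Arguments.
Unset Strict Implicit.
Unset Printing Implicit Defensive.

Record sgraph := SGraph {
  vertex :> finType;
  adj : rel vertex;
  adj_sym : symmetric adj;
  adj_irrefl : irreflexive adj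
}.

Definition neighbors (G : sgraph) (x : G) : {set G} := [set y | adj x y].

Definition max_degree (G : sgraph) : nat := \max_(x : G) #|neighbors x|.

(* The null graph is not connected. *)
Definition connected_graph (G : sgraph) : Prop :=
  0 < #|G| /\ forall x y : G, connect (@adj G) x y.

Definition isomorphic (G H : sgraph) : Prop :=
  exists2 f : G -> H, bijective f & forall x y : G, adj (f x) (f y) = adj x y.

Definition isolated (G : sgraph) (x : G) : Prop := neighbors x = set0.

Definition proper_coloring (G : sgraph) (C : eqType) (phi : G -> C) : Prop :=
  forall x y : G, adj x y -> phi x <> phi y.

Definition odd_coloring (G : sgraph) (C : eqType) (phi : G -> C) : Prop :=
  proper_coloring phi /\
  forall x : G, ~ isolated x ->
    exists c : C, odd #|[set y in neighbors x | phi y == c]|.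

(* ordS is the successor modulo the size of the ordinal type. *)
Definition cycle_adj (n : nat) : rel 'I_n :=
  fun i j => (j == ordS i) || (i == ordS j).

Lemma cycle_adj_sym n : symmetric (@cycle_adj n).
Proof. by move=> i j; rewrite /cycle_adj orbC. Qed.

Lemma cycle_adj_irrefl n : 1 < n -> irreflexive (@cycle_adj n).
Proof.
move=> n_gt1 i; rewrite /cycle_adj orbb; apply/negbTE/eqP => /(congr1 val) /=.
have [lt_in|] := ltnP i.+1 n; first by rewrite modn_small // => /n_Sn.
move=> le_ni; have -> : i.+1 = n by apply/eqP; rewrite eqn_leq ltn_ord.
rewrite modnn => i0.
by move: le_ni; rewrite i0 leqNgt n_gt1.
Qed.

(* The cycle on n vertices, for n >= 3. *)
Definition cycle_graph (n : nat) (n_ge3 : 2 < n) : sgraph :=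
  SGraph (@cycle_adj_sym n) (cycle_adj_irrefl (ltnW n_ge3)).

Definition C5 : sgraph := @cycle_graph 5 isT.

(* Main.v *)
(* Color greedily towards a last vertex r.  A color of a vertex v can only be blocked by a
   neighbor of v that already carries it, or by a neighbor of v whose neighborhood it would
   complete with all multiplicities even; each neighbor blocks at most one color in each of
   these two ways.  A vertex other than r still has an uncolored neighbor, hence at most
   2 Delta - 1 blocked colors, so a counterexample is stuck at r with exactly 2 Delta blocked
   colors: G is Delta-regular and the blocked colors at r are pairwise distinct and exhaust
   L r.  If Delta >= 3, changing the color of a neighbor w of r (with a second forbidden color
   when w and r have a common neighbor) yields a configuration violating this rigidity.  The
   case Delta = 1 is immediate, and for Delta = 2 the graph is a cycle whose square must be
   colored from lists of size four. *)
Require Import Defs.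
From mathcomp Require Import all_boot finmap.
From mathcomp Require Import zify.
From Stdlib Require Import Classical_Prop.

Set Implicit Arguments.
Unset Strict Implicit.
Unset Printing Implicit Defensive.

(** * Counting colors through their blockers *)

Section Blocking.
Variables (C : eqType) (I : finType) (A : seq C) (b : I -> C -> bool).
Hypothesis uniqA : uniq A.

(** Sending each color to one of its blockers is injective, since a blocker blocks at most one
    color. *)
Lemma size_le_blockers (T : {set I}) :
    (forall c, c \in A -> exists2 t, t \in T & b t c) ->
    (forall t c c', t \in T -> c \in A -> c' \in A -> b t c -> b t c' -> c = c') ->
  size A <= #|T|.
Proof.
move=> blocked b_inj.
pose pk c := [pick t in T | b t c].
have pkP c : c \in A -> exists t, [/\ pk c = Some t, t \in T & b t c].
  move=> /blocked [t tT btc]; rewrite /pk; case: pickP => [t' /andP[]|/(_ t)].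
    by exists t'.
  by rewrite tT btc.
have pk_inj : {in A &, injective pk}.
  move=> c c' cA c'A; have [t [-> tT btc]] := pkP _ cA.
  have [t' [-> _ btc']] := pkP _ c'A => -[tt']; subst t'.
  exact: b_inj tT cA c'A btc btc'.
rewrite cardE -(size_map Some (enum _)) -(size_map pk A); apply: uniq_leq_size.
  by rewrite map_inj_in_uniq.
move=> _ /mapP [c /pkP [t [-> tT _]] ->].
by rewrite mem_map ?mem_enum // => ? ? [].
Qed.

(** If every color had a blocker other than [t], then [T :\ t] would block all of [A] with fewer
    than [size A] elements. *)
Lemma tight_blockers (T : {set I}) :
    (forall c, c \in A -> exists2 t, t \in T & b t c) ->
    (forall t c c', t \in T -> c \in A -> c' \in A -> b t c -> b t c' -> c = c') ->
    #|T| <= size A ->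
  forall t, t \in T ->
    exists c, [/\ c \in A, b t c & forall t', t' \in T -> b t' c -> t' = t].
Proof.
move=> blocked b_inj leTA t tT.
have [/hasP [c cA /existsPn only]|/hasPn others] :=
    boolP (has (fun c => ~~ [exists t', (t' \in T :\ t) && b t' c]) A).
  have only_t t' : t' \in T -> b t' c -> t' = t.
    move=> t'T btc; apply/eqP; move: (only t').
    by rewrite btc andbT !inE t'T andbT negbK.
  have [t' t'T bt'c] := blocked c cA.
  by exists c; split => //; rewrite -(only_t _ t'T bt'c).
have : size A <= #|T :\ t|.
  apply: size_le_blockers => [c /others|t' c c' /setD1P [_]]; last exact: b_inj.
  by rewrite negbK => /existsP [t' /andP[? ?]]; exists t'.
by move=> /(leq_trans leTA); rewrite (cardsD1 t T) tT ltnn.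
Qed.

End Blocking.

(** * Color multiplicities and the parity condition *)

Definition recolor (T : eqType) (C : Type) (phi : T -> C) (v : T) (c : C) : T -> C :=
  fun x => if x == v then c else phi x.

Definition color_count (T : finType) (C : eqType) (phi : T -> C) (A : {set T}) (c : C) :=
  #|[set x in A | phi x == c]|.

Section Counting.
Variables (T : finType) (C : eqType).
Implicit Types (phi : T -> C) (A : {set T}).

Lemma color_countD1 phi A v c : v \in A ->
  color_count phi A c = (phi v == c) + color_count phi (A :\ v) c.
Proof.
move=> vA; rewrite /color_count (cardsD1 v) !inE vA; congr (_ + #|pred_of_set _|).
by apply/setP => x; rewrite !inE andbA.
Qed.

Lemma eq_color_count phi phi' A c : {in A, phi =1 phi'} ->
  color_count phi A c = color_count phi' A c.
Proof.
move=> eq_phi; congr #|pred_of_set _|; apply/setP => x; rewrite !inE.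
by case: (boolP (x \in A)) => // /eq_phi ->.
Qed.

Lemma color_count_recolor phi A v c e : v \in A ->
  color_count (recolor phi v c) A e = (c == e) + color_count phi (A :\ v) e.
Proof.
move=> vA; rewrite (color_countD1 _ _ vA) /recolor eqxx; congr addn.
by apply: eq_color_count => x /setD1P [/negbTE ->].
Qed.

End Counting.

Section Happy.
Variables (G : sgraph) (C : eqType).
Implicit Types (phi : G -> C) (x y v : G).

Definition happy phi x : bool :=
  [exists y in neighbors x, odd (color_count phi (neighbors x) (phi y))].

Lemma happyP phi x :
  reflect (exists c, odd (color_count phi (neighbors x) c)) (happy phi x).
Proof.
apply: (iffP existsP) => [[y /andP [_ ?]]|[c codd]]; first by exists (phi y).
have : 0 < color_count phi (neighbors x) c by case: color_count codd.
rewrite card_gt0 => /set0Pn [y]; rewrite inE => /andP [yx /eqP phiy].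
by exists y; rewrite yx phiy.
Qed.

Lemma unhappy_even phi x c : ~~ happy phi x ->
  odd (color_count phi (neighbors x) c) = false.
Proof. by move=> /happyP unhappy; apply/negP => ?; apply: unhappy; exists c. Qed.

Lemma eq_happy phi phi' x : {in neighbors x, phi =1 phi'} ->
  happy phi x = happy phi' x.
Proof.
move=> eq_phi; apply/happyP/happyP => -[c codd]; exists c; move: codd;
  by rewrite (eq_color_count _ eq_phi).
Qed.

(** If [c] at [v] makes all multiplicities around [x] even, then [c] is odd on [neighbors x :\ v],
    and only giving [c] to [v] makes it even. *)
Lemma unhappy_recolor_inj phi v x c c' : v \in neighbors x ->
  ~~ happy (recolor phi v c) x -> ~~ happy (recolor phi v c') x -> c = c'.
Proof.
move=> vx /(unhappy_even c) + /(unhappy_even c).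
rewrite !color_count_recolor // eqxx !oddD /= => /negbFE ->.
by case: eqP => [->|].
Qed.

Lemma two_colors_happy phi x y z : y \in neighbors x -> z \in neighbors x ->
  #|neighbors x| = 2 -> phi y != phi z -> happy phi x.
Proof.
move=> yx zx card2 yz; apply/happyP; exists (phi y).
have zy : z \in neighbors x :\ y.
  by rewrite !inE in zx *; rewrite zx andbT; apply: contraNneq yz => ->.
rewrite (color_countD1 _ _ yx) (color_countD1 _ _ zy) eqxx eq_sym (negbTE yz).
suff /eqP -> : (neighbors x :\ y) :\ z == set0.
  by rewrite /color_count eq_card0 // => u; rewrite !inE.
by rewrite -cards_eq0; move: card2; rewrite (cardsD1 y) yx (cardsD1 z) zy => -[/eqP].
Qed.

End Happy.

(** * Partial list colorings and their one-vertex extensions *)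

Section PartialColoring.
Variables (G : sgraph) (C : choiceType) (L : G -> {fset C}).
Implicit Types (S : {set G}) (phi : G -> C) (x y v : G).

Lemma adj_neq x y : adj x y -> x != y.
Proof. by apply: contraTneq => ->; rewrite adj_irrefl. Qed.

(* Restriction to S of an L-coloring in which every vertex whose neighborhood is already
   colored satisfies its parity constraint. *)
Definition valid S phi : Prop :=
  [/\ {in S, forall x, phi x \in L x},
      {in S &, forall x y, adj x y -> phi x != phi y}
    & forall x, ~ isolated x -> neighbors x \subset S -> happy phi x].

Lemma valid_sub S S' phi : S' \subset S -> valid S phi -> valid S' phi.
Proof.
move=> /subsetP sub [inL proper hap]; split=> [x /sub /inL //|x y /sub xS /sub|x iso].
  exact: proper.
by move=> NS'; apply: hap => //; apply: subset_trans NS' _; apply/subsetP.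
Qed.

Lemma valid_setT phi : valid setT phi ->
  odd_coloring phi /\ forall v, phi v \in L v.
Proof.
move=> [inL proper hap]; split; last by move=> v; apply: inL.
split=> [x y xy|x iso]; first by apply/eqP/proper.
by have /happyP := hap x iso (subsetT _).
Qed.

(** A neighbor can obstruct in two ways, hence the sum type: [inl y] through properness, [inr y]
    through parity at [y] once [v] is colored. *)
Definition blocks phi v (t : G + G) (c : C) : bool :=
  match t with
  | inl y => phi y == c
  | inr y => ~~ happy (recolor phi v c) y
  end.

Definition blockers S v : {set G + G} :=
  [set inl y | y in neighbors v :&: S] :|:
  [set inr y | y in [set y in neighbors v | neighbors y \subset v |: S]].

Lemma mem_blockers_inl S v y : (inl y \in blockers S v) = adj v y && (y \in S).
Proof.
rewrite in_setU (mem_imset _ _ (@inl_inj _ _)) 2!inE.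
by case: imsetP => [[?]|] //; rewrite orbF.
Qed.

Lemma mem_blockers_inr S v y :
  (inr y \in blockers S v) = adj v y && (neighbors y \subset v |: S).
Proof.
rewrite in_setU (mem_imset _ _ (@inr_inj _ _)) 2!inE.
by case: imsetP => [[?]|] //.
Qed.

Lemma card_blockers S v :
  #|blockers S v| <= #|neighbors v :&: S| + #|neighbors v|.
Proof.
apply: leq_trans (leq_card_setU _ _) (leq_add (leq_imset_card _ _) _).
apply: leq_trans (leq_imset_card _ _) (subset_leq_card _).
by apply/subsetP => y; rewrite inE => /andP[].
Qed.

Lemma valid_recolor S phi v c : valid S phi -> c \in L v ->
    (forall t, t \in blockers S v -> ~~ blocks phi v t c) ->
  valid (v |: S) (recolor phi v c).
Proof.
move=> [inL proper hap] cL free; rewrite /recolor; split.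
- by move=> x; rewrite !inE; case: eqP => [->|_ /=] // /inL.
- have vy y : y \in S -> adj v y -> c != phi y.
    by move=> yS vy; rewrite eq_sym (free (inl y)) // mem_blockers_inl vy.
  move=> x y; rewrite !inE.
  case: (eqVneq x v) => [->|_ /=]; case: (eqVneq y v) => [->|_ /=].
  + by rewrite adj_irrefl.
  + by move=> _; apply: vy.
  + by move=> xS _; rewrite adj_sym eq_sym; apply: vy.
  + by move=> xS yS; apply: proper.
move=> x iso NS; have [vx|vx] := boolP (adj v x).
  by have := free (inr x); rewrite mem_blockers_inr vx NS negbK; apply.
have vN : v \notin neighbors x by rewrite inE adj_sym.
rewrite (@eq_happy _ _ _ phi).
  apply: hap => //; apply/subsetP => y yN; move/subsetP/(_ y yN): NS.
  by rewrite !inE => /predU1P [yv|//]; rewrite -yv yN in vN.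
by move=> y yN; case: eqP => // yv; rewrite -yv yN in vN.
Qed.

Lemma blocks_inj S phi v t c c' : t \in blockers S v ->
  blocks phi v t c -> blocks phi v t c' -> c = c'.
Proof.
case: t => y; first by move=> _ /eqP <- /eqP.
rewrite mem_blockers_inr => /andP [vy _]; apply: unhappy_recolor_inj.
by rewrite inE adj_sym.
Qed.

Lemma extend_coloring S phi v (A : seq C) (T : {set G + G}) : valid S phi ->
    uniq A -> {subset A <= L v} -> T \subset blockers S v ->
    (forall t c, c \in A -> t \in blockers S v -> t \notin T -> ~~ blocks phi v t c) ->
    #|T| < size A ->
  exists2 c, c \in A & valid (v |: S) (recolor phi v c).
Proof.
move=> val uniqA subA /subsetP subT outT; rewrite ltnNge => big.
have [/hasP [c cA /existsPn free]|/hasPn blocked] :=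
    boolP (has (fun c => ~~ [exists t, (t \in blockers S v) && blocks phi v t c]) A).
  exists c => //; apply: valid_recolor => // [|t tB]; first exact: subA.
  by have := free t; rewrite tB.
case/negP: big; apply: (@size_le_blockers _ _ _ (blocks phi v)) => //.
  move=> c cA; have := blocked c cA; rewrite negbK => /existsP [t /andP [tB btc]].
  by exists t => //; apply: contraTT btc; apply: outT.
by move=> t c c' /subT tB _ _; apply: blocks_inj tB.
Qed.

End PartialColoring.

Lemma size_filter_notin (T : eqType) (s D : seq T) : uniq s ->
  size s <= size [seq c <- s | c \notin D] + size D.
Proof.
move=> uniq_s; rewrite -(count_predC (mem D) s) addnC size_filter leq_add2l.
rewrite -size_filter; apply: uniq_leq_size; first exact: filter_uniq.
by move=> c; rewrite mem_filter => /andP[].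
Qed.

Lemma boundary_edge (G : sgraph) (U : {set G}) r z : connect (@adj G) r z ->
  r \in U -> z \notin U -> exists x y, [/\ x \notin U, y \in U & adj x y].
Proof.
move=> rz rU zU.
have [/existsP [x /existsP [y /and3P [? ? ?]]]|no_edge] :=
    boolP [exists x, exists y, [&& x \notin U, y \in U & adj x y]].
  by exists x, y.
case/negP: zU; rewrite -(closed_connect _ rz) //.
apply: intro_closed; first exact/sym_connect_sym/adj_sym.
move=> x y xy xU; apply: contraNT no_edge => yU.
by apply/existsP; exists y; apply/existsP; exists x; rewrite yU xU adj_sym.
Qed.

(** * Rigidity at the last vertex *)

Section Extremal.
Variables (G : sgraph) (Delta : nat) (C : choiceType) (L : G -> {fset C}).
Hypotheses (G_connected : forall x y : G, connect (@adj G) x y)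
  (degree_le : forall x : G, #|neighbors x| <= Delta)
  (Delta_gt0 : 0 < Delta)
  (card_L : forall v : G, #|` L v| = 2 * Delta).

(** Induction on the number of vertices to color: a vertex [x] with a neighbor in [U] is left for
    last. That neighbor stays uncolored, so [x] has at most [Delta - 1] blockers of the first kind
    and [Delta] of the second. *)
Lemma valid_away_from (U : {set G}) r : r \in U ->
  exists phi, valid L (~: U) phi.
Proof.
have [k] := ubnP #|~: U|; elim: k U => // k IH U ltUk rU.
have [/eqP -> {k IH U ltUk rU}|/set0Pn [z]] := boolP (~: U == set0).
  have nonempty v : exists c, c \in L v.
    by apply/fset0Pn; rewrite -cardfs_gt0 card_L muln_gt0.
  exists (fun v => xchoose (nonempty v)); split=> [x|x y|x]; rewrite ?inE //.
  by rewrite subset0 => iso /eqP.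
rewrite inE => /(boundary_edge (G_connected r z) rU) [x [y [xU yU xy]]].
have xDU : ~: U = x |: ~: (x |: U).
  by apply/setP => u; rewrite !inE; case: eqP => // ->.
have xS : x \notin ~: (x |: U) by rewrite !inE eqxx.
have [||phi val] := IH (x |: U); last 1 first.
- have [c cL val'] : exists2 c, c \in enum_fset (L x)
      & valid L (x |: ~: (x |: U)) (recolor phi x c).
    apply: (extend_coloring val (fset_uniq _) _ (subxx _)) => [//|t c _ -> //|].
    apply: (leq_ltn_trans (card_blockers _ _)); rewrite [size _]card_L mul2n -addnn.
    rewrite -addSn leq_add //; apply: leq_trans (degree_le x).
    apply: proper_card; apply/properP; split; first exact: subsetIl.
    by exists y; rewrite !inE ?xy ?yU ?orbT.
  by exists (recolor phi x c); rewrite xDU.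
- by move: ltUk; rewrite xDU cardsU1 xS.
- by rewrite !inE rU orbT.
Qed.

Hypothesis uncolorable : ~ exists phi, odd_coloring phi /\ forall v, phi v \in L v.

Section LastVertex.
Variables (r : G) (phi : G -> C).
Hypothesis phi_valid : valid L (~: [set r]) phi.

Lemma mem_last_blockers y :
  ((inl y \in blockers (~: [set r]) r) = adj r y) *
  ((inr y \in blockers (~: [set r]) r) = adj r y).
Proof.
rewrite mem_blockers_inl mem_blockers_inr setUCr subsetT andbT !inE.
by split=> //; apply/andb_idr => /adj_neq; rewrite eq_sym.
Qed.

Lemma all_blocked c : c \in L r ->
  exists2 t, t \in blockers (~: [set r]) r & blocks phi r t c.
Proof.
move=> cL; apply/exists_inP; apply: contraPT uncolorable => free.
apply; exists (recolor phi r c); apply: (@valid_setT _ _ L).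
rewrite -(setUCr [set r]); apply: valid_recolor => // t tB; apply: contraNN free.
by move=> btc; apply/exists_inP; exists t.
Qed.

Lemma card_last_blockers : #|blockers (~: [set r]) r| <= 2 * #|neighbors r|.
Proof.
apply: leq_trans (card_blockers _ _) _; rewrite mul2n -addnn leq_add2r.
exact/subset_leq_card/subsetIl.
Qed.

Lemma degree_last : #|neighbors r| = Delta.
Proof.
apply/eqP; rewrite eqn_leq degree_le -(leq_pmul2l (isT : 0 < 2)) -(card_L r).
apply: leq_trans card_last_blockers; apply: (size_le_blockers (fset_uniq _)).
  exact: all_blocked.
by move=> t c c' tB _ _; apply: blocks_inj tB.
Qed.

(** There are no more blockers than colors, so each is the sole blocker of some color; the lemmas
    below read this off for both kinds. *)
Lemma tight_last t : t \in blockers (~: [set r]) r ->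
  exists c, [/\ c \in L r, blocks phi r t c &
    forall t', t' \in blockers (~: [set r]) r -> blocks phi r t' c -> t' = t].
Proof.
apply: (tight_blockers (fset_uniq (L r)) all_blocked).
  by move=> ? c c' tB _ _; apply: blocks_inj tB.
by rewrite [size _]card_L -degree_last card_last_blockers.
Qed.

Lemma last_color_inL y : adj r y -> phi y \in L r.
Proof.
by rewrite -(mem_last_blockers y).1 => /tight_last [c [cL /eqP -> _]].
Qed.

Lemma last_block_unique y t : adj r y -> t \in blockers (~: [set r]) r ->
  blocks phi r t (phi y) -> t = inl y.
Proof.
move=> ry tB btc; move: ry; rewrite -(mem_last_blockers y).1 => /tight_last.
by move=> [c [cL /eqP eq_c]]; apply; rewrite -?eq_c.
Qed.

Lemma last_colors_inj y z : adj r y -> adj r z -> phi y = phi z -> y = z.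
Proof.
move=> ry rz eq_yz; have := @last_block_unique z (inl y) rz.
by rewrite (mem_last_blockers y).1 ry => /(_ isT); rewrite /= eq_yz => /(_ (eqxx _)) [].
Qed.

Lemma last_unhappy y : adj r y -> exists c, [/\ c \in L r,
  ~~ happy (recolor phi r c) y & forall z, adj r z -> phi z != c].
Proof.
rewrite -(mem_last_blockers y).2 => /tight_last [c [cL bc only]].
exists c; split=> // z rz; apply/negP => /eqP phiz.
have := only (inl z); rewrite (mem_last_blockers z).1 rz /= phiz => /(_ isT).
by move/(_ (eqxx _)).
Qed.

End LastVertex.

Lemma degree_eq (r : G) : #|neighbors r| = Delta.
Proof. by have [phi /degree_last] := valid_away_from (set11 r). Qed.

(** For [Delta = 1], a neighbor [w] of [r] sees only [r], so every color of [r] has multiplicity one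
    there and [inr w] blocks nothing. *)
Lemma Delta_neq1 (r : G) : Delta != 1.
Proof.
apply/eqP => Delta1; have [phi val] := valid_away_from (set11 r).
have [w] : exists w, w \in neighbors r by apply/card_gt0P; rewrite degree_eq.
rewrite inE => rw; have [c [_ /(unhappy_even c) + _]] := last_unhappy val rw.
rewrite color_count_recolor ?inE 1?adj_sym // eqxx.
suff -> : neighbors w :\ r = set0 by rewrite /color_count eq_card0 // => u; rewrite !inE.
apply/eqP; rewrite -cards_eq0; have := degree_eq w.
by rewrite (cardsD1 r) inE adj_sym rw Delta1 => -[/eqP].
Qed.

(* With three distinctly colored neighbors, r keeps a color of multiplicity one whatever
   becomes of the color of w. *)
Lemma happy_recolor_neighbor r phi w c : valid L (~: [set r]) phi -> 2 < Delta ->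
  adj r w -> happy (recolor phi w c) r.
Proof.
move=> val Delta_gt2 rw; have wN : w \in neighbors r by rewrite inE.
have : 1 < #|neighbors r :\ w|.
  by move: Delta_gt2; rewrite -(degree_eq r) (cardsD1 w) wN.
case/card_gt1P => y [z [yN zN yz]].
have [y' yN' neq_c] : exists2 y, y \in neighbors r :\ w & phi y != c.
  have [eq_c|] := eqVneq (phi y) c; last by exists y.
  exists z => //; apply: contraNneq yz => phiz; apply/eqP.
  move: yN zN; rewrite !inE => /andP [_ ry] /andP [_ rz].
  by apply: (last_colors_inj val ry rz); rewrite phiz.
apply/happyP; exists (phi y'); rewrite color_count_recolor // eq_sym (negbTE neq_c).
rewrite (color_countD1 _ _ yN') eqxx /color_count eq_card0 // => u.
rewrite !inE; apply/negP => /andP [/and3P [uy' _ ru] /eqP eq_u]; case/eqP: uy'.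
by move: yN'; rewrite !inE => /andP [_ ry']; apply: (last_colors_inj val).
Qed.

(** Let m be the number of common neighbors of [w] and [r]. The blockers at [w] that matter are its
    [Delta - 1] colored neighbors and, for parity, those of its neighbors other than [r] not
    adjacent to the uncolored [r]: at most 2 Delta - 2 - m in all. This leaves m + 2 colors, more
    than [D] can forbid. *)
Lemma recolor_neighbor r phi w (D : seq C) : valid L (~: [set r]) phi -> 2 < Delta ->
    adj r w -> size D < 2 + #|neighbors w :&: neighbors r| ->
  exists b, [/\ b \in L w, b \notin D & valid L (~: [set r]) (recolor phi w b)].
Proof.
move=> val Delta_gt2 rw smallD; pose S := ~: [set r; w].
have wr : w != r by rewrite eq_sym; apply: adj_neq.
have wS : w |: S = ~: [set r].
  apply/setP => u; rewrite !inE negb_or; case: (eqVneq u w) => [->|]; last by rewrite andbT.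
  by rewrite wr.
have valS : valid L S phi.
  by apply: valid_sub val; rewrite setCS sub1set !inE eqxx.
have rN : r \in neighbors w by rewrite inE adj_sym.
have cardN : #|neighbors w :\ r| = Delta.-1.
  by have := degree_eq w; rewrite (cardsD1 r) rN => <-.
have [|||||b] := extend_coloring (v := w) (A := [seq c <- L w | c \notin D])
    (T := blockers S w :\ inr r) valS.
- exact/filter_uniq/fset_uniq.
- by move=> c; rewrite mem_filter => /andP[].
- exact: subsetDl.
(* Only [inr r] was dropped from the blockers, and [r] stays happy for every color of [w]. *)
- move=> t c _ tB; rewrite in_setD1 tB andbT negbK => /eqP -> /=.
  by rewrite negbK; apply: happy_recolor_neighbor.
- have := size_filter_notin D (fset_uniq (L w)); rewrite [size (L w)]card_L => le_A.
  have : #|blockers S w :\ inr r| <=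
      #|neighbors w :\ r| + #|(neighbors w :\ r) :\: neighbors r|.
    apply: leq_trans (leq_add (leq_imset_card inl _) (leq_imset_card inr _)).
    apply: leq_trans (leq_card_setU _ _); apply/subset_leq_card/subsetP.
    case=> y; rewrite in_setD1 ?mem_blockers_inl ?mem_blockers_inr in_setU.
      move=> /andP [_ /andP [wy]]; rewrite !inE negb_or => /andP [yr _].
      by apply/orP; left; apply/imsetP; exists y; rewrite // !inE yr.
    move=> /andP [yr /andP [wy]]; rewrite wS => sub.
    apply/orP; right; apply/imsetP; exists y; rewrite // !inE wy.
    rewrite (contraNneq _ yr) ?andbT => [|-> //].
    by apply/negP => ry; move/subsetP/(_ r): sub; rewrite !inE adj_sym ry eqxx => /(_ isT).
  rewrite (cardsD (_ w :\ r)) cardN; have -> :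
      (neighbors w :\ r) :&: neighbors r = neighbors w :&: neighbors r.
    apply/setP => u; rewrite !inE.
    by case: (eqVneq u r) => [->|_]; rewrite ?adj_irrefl ?andbF.
  have : #|neighbors w :&: neighbors r| <= #|neighbors w :\ r|.
    apply/subset_leq_card/subsetP => u; rewrite !inE => /andP [-> ru].
    by rewrite andbT eq_sym adj_neq.
  rewrite cardN; move: smallD le_A.
  move: (size D) (size (filter _ _)) #|_ :&: _| #|_ :\ inr r|; lia.
rewrite mem_filter wS => /andP [bD bL] valb; by exists b.
Qed.

Lemma Delta_le2 (r : G) : Delta <= 2.
Proof.
rewrite leqNgt; apply/negP => Delta_gt2; have [phi val] := valid_away_from (set11 r).
have [w] : exists w, w \in neighbors r by apply/card_gt0P; rewrite degree_eq.
rewrite inE => rw.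
have [common0|/set0Pn [x]] := eqVneq (neighbors w :&: neighbors r) set0.
  have [|b [_ + valb]] := @recolor_neighbor r phi w [:: phi w] val Delta_gt2 rw.
    by rewrite common0 cards0.
  rewrite inE => bw; have := last_color_inL valb rw; rewrite /recolor eqxx => bL.
  (* What blocks [b] at [r] under the old coloring still does after [w] receives [b], since no
     neighbor of [r] sees [w]. Uniqueness makes it [inl w], although [phi w] is not [b]. *)
  have [t tB bt] := all_blocked val bL.
  have : t = inl w.
    apply: (last_block_unique valb rw tB); rewrite {2}/recolor eqxx.
    case: t tB bt => y /=; rewrite !mem_last_blockers => ry bt.
      by rewrite /recolor; case: ifP.
    rewrite -(@eq_happy _ _ (recolor phi r b)) // => u uy.
    rewrite /recolor; case: eqP => // _; case: eqP => // uw.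
    by move/setP/(_ y): common0; rewrite !inE ry adj_sym -uw -[adj _ _]inE uy.
  by move=> eq_t; move: bt; rewrite eq_t /= => /eqP eq_b; rewrite eq_b eqxx in bw.
(* At a common neighbor [x], the colors [o] and [o'] of [r] that make [x] unhappy before and after
   recoloring [w] both differ from [b]. So the multiplicity of [b] around [x] changes by exactly
   one, yet is even both times. *)
rewrite !inE => /andP [wx rx]; have [o [oL unhappy_o _]] := last_unhappy val rx.
have [|b [_ + valb]] := @recolor_neighbor r phi w [:: phi w; o] val Delta_gt2 rw.
  by rewrite /= ltnS; apply/card_gt0P; exists x; rewrite !inE wx.
rewrite !inE negb_or => /andP [bw bo].
have [o' [_ unhappy_o' /(_ w rw)]] := last_unhappy valb rx.
rewrite /recolor eqxx => bo'.
have rX : r \in neighbors x by rewrite inE adj_sym.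
have wX : w \in neighbors x :\ r by rewrite !inE adj_sym wx andbT eq_sym adj_neq.
have := unhappy_even b unhappy_o; have := unhappy_even b unhappy_o'.
rewrite !color_count_recolor // (color_countD1 phi _ wX) eqxx.
rewrite ![_ == b]eq_sym (negbTE bo) (negbTE bw) (negbTE bo') !add0n oddD /=.
by move=> /negbFE ->.
Qed.

End Extremal.

(** * Cycles *)

Section TwoRegular.
Variable G : sgraph.
Hypotheses (G_connected : forall x y : G, connect (@adj G) x y)
  (degree2 : forall x : G, #|neighbors x| = 2).

Lemma neighbors2 (x y z : G) : adj x y -> adj x z -> y != z -> neighbors x = [set y; z].
Proof.
move=> xy xz yz; apply/esym/eqP; rewrite eqEcard degree2 cards2 yz andbT.
by apply/subsetP => u; rewrite !inE => /orP [] /eqP ->.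
Qed.

(** The implication sits under the quantifier so that a choice exists for every pair, adjacent or
    not, and the walk is a total iteration. *)
Lemma other_neighbor (x y : G) : exists z, adj x y ==> (adj y z && (z != x)).
Proof.
have : 0 < #|neighbors y :\ x|.
  by have := degree2 y; rewrite (cardsD1 x); case: (x \in _); lia.
by case/card_gt0P => z; rewrite !inE => /andP [zx yz]; exists z; rewrite yz zx implybT.
Qed.

Lemma infinite_walk (a b : G) : adj a b -> exists f : nat -> G,
  [/\ f 0 = a, f 1 = b, forall i, adj (f i) (f i.+1) & forall i, f i.+2 != f i].
Proof.
move=> ab; pose step p := (p.2, xchoose (other_neighbor p.1 p.2)).
pose dart i := iter i step (a, b).
have dart_adj i : adj (dart i).1 (dart i).2.
  elim: i => //= i IH.
  by have /implyP/(_ IH)/andP[] := xchooseP (other_neighbor (dart i).1 (dart i).2).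
exists (fun i => (dart i).1); split=> // i.
by have /implyP/(_ (dart_adj i))/andP[] := xchooseP (other_neighbor (dart i).1 (dart i).2).
Qed.

(** A non-backtracking walk first repeats by returning to its start; the vertices met are then
    closed under adjacency, hence all of [G]. Adding [n.-1] modulo [n] gives the cyclic predecessor,
    also at 0. *)
Lemma cycle_walk (a b : G) : adj a b -> exists n (f : nat -> G),
  [/\ 2 < n /\ (f 0 = a /\ f 1 = b), {in gtn n &, injective f},
      forall x, exists i, (i < n) && (f i == x) &
      forall i, i < n ->
        neighbors (f i) = [set f (i.+1 %% n); f ((i + n.-1) %% n)]].
Proof.
move=> /infinite_walk [f [f0 f1 fadj f2]].
have fadj' i : adj (f i.+1) (f i) by rewrite adj_sym.
have fN i : neighbors (f i.+1) = [set f i; f i.+2].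
  by apply: neighbors2; rewrite // eq_sym.
have repeat : exists j, [exists i : 'I_j, f i == f j].
  have : ~~ injectiveb (fun i : 'I_#|G|.+1 => f i).
    by apply/injectiveP => /leq_card; rewrite card_ord ltnn.
  case/injectivePn => x [y neq fxy]; wlog xy : x y neq fxy / x < y.
    case: (ltngtP x y) => [xy|yx|/val_inj eq_xy] WLOG; first exact: (WLOG x y).
      by apply: (WLOG y x); rewrite // eq_sym.
    by rewrite eq_xy eqxx in neq.
  by exists y; apply/existsP; exists (Ordinal xy); apply/eqP.
case: (ex_minnP repeat) => n /existsP [[i ltin] /= /eqP fin] min_n.
have f_inj : {in gtn n &, injective f}.
  move=> x y; rewrite !inE; wlog xy : x y / x < y.
    by case: (ltngtP x y) => // xy WLOG xn yn fxy; [|symmetry]; apply: WLOG.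
  move=> _ yn fxy; have : n <= y.
    by apply: min_n; apply/existsP; exists (Ordinal xy); rewrite /= fxy.
  by rewrite leqNgt yn.
(* If the walk first returned to [f k.+1], its last new vertex [f m] would be [f k] or [f k.+2]: an
   earlier repetition, a backtrack or a loop. *)
have fn0 : f n = f 0.
  case: i ltin fin => // k; case: n f_inj {min_n} => // m f_inj ltkm fkm.
  have : f m \in neighbors (f k.+1) by rewrite inE fkm.
  rewrite fN !inE => /orP [] /eqP fm.
    by have := f_inj _ _ _ _ fm; rewrite !inE => eq_mk; lia.
  have [ltk2|lek2] := ltnP k.+2 m.+1.
    have mk : m = k.+2 by apply: f_inj; rewrite ?inE.
    by have := f2 k.+1; rewrite fkm mk eqxx.
  have mk : k.+1 = m by lia.
  by have := fadj m; rewrite -fkm mk adj_irrefl.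
have n_gt2 : 2 < n.
  case: n ltin fn0 {fin min_n f_inj} => [|[|[|n]]] // _ fn0.
    by have := fadj 0; rewrite fn0 adj_irrefl.
  by have := f2 0; rewrite fn0 eqxx.
have fadj_last : adj (f 0) (f n.-1).
  by rewrite adj_sym -fn0 -[in f n](ltn_predK n_gt2).
have fNn j : j < n -> neighbors (f j) = [set f (j.+1 %% n); f ((j + n.-1) %% n)].
  case: j => [_|j ltjn].
    rewrite !modn_small; [|lia|lia]; apply: neighbors2 => //.
    by apply: contraTneq n_gt2 => /f_inj; rewrite !inE => eq_n; lia.
  rewrite addSnnS (ltn_predK n_gt2) modnDr (@modn_small j n (ltnW ltjn)) fN setUC.
  congr [set _; _]; have [lt|] := ltnP j.+2 n; first by rewrite modn_small.
  by move=> le; rewrite (_ : j.+2 = n) ?modnn ?fn0 //; lia.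
exists n, f; split=> // x; pose U := [set f i | i : 'I_n].
suff /imsetP [j _ ->] : x \in U by exists j; rewrite eqxx ltn_ord.
have fU j : f (j %% n) \in U.
  have lt : j %% n < n by rewrite ltn_mod; lia.
  by apply/imsetP; exists (Ordinal lt).
have f0U : f 0 \in U by have := fU 0; rewrite mod0n.
apply/negPn/negP => /(boundary_edge (G_connected _ x) f0U) [y [z [+ zU yz]]].
case/negP; case/imsetP: zU yz => j _ ->; rewrite adj_sym => yz.
have : y \in neighbors (f j) by rewrite inE.
by rewrite fNn // !inE => /orP [] /eqP ->; apply: fU.
Qed.

End TwoRegular.

(* Cyclic pattern of period n = 3a + 4b, b = n mod 3: b blocks 0123 followed by a blocks 012. *)
Definition block_pattern (n i : nat) : nat :=
  if i < 4 * (n %% 3) then i %% 4 else (i - 4 * (n %% 3)) %% 3.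

Lemma block_pattern_lt n i : block_pattern n i < 4.
Proof. by rewrite /block_pattern; case: ifP => _; lia. Qed.

(** Both kinds of block begin with 01 and end in 12 or 23, so three consecutive entries differ even
    across a boundary or the cyclic wrap. *)
Lemma block_pattern_neq n i : 2 < n -> n != 5 -> i < n ->
  (block_pattern n i != block_pattern n (i.+1 %% n)) &&
  (block_pattern n i != block_pattern n (i.+2 %% n)).
Proof.
move=> n_gt2 n_neq5 ltin.
(* Among [n > 2], the blocks of length four fail to fit only for [n = 5]. *)
have n_ge : 4 * (n %% 3) <= n by lia.
have n3 : n %% 3 < 3 by lia.
have [q nE] : exists q, n = 4 * (n %% 3) + 3 * q.
  by exists (n %/ 3 - n %% 3); lia.
have mod1 : i.+1 %% n = if i.+1 < n then i.+1 else 0.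
  case: ltnP => [lt|le]; first by rewrite modn_small.
  by rewrite (_ : i.+1 = n) ?modnn //; lia.
have mod2 : i.+2 %% n = if i.+2 < n then i.+2 else i.+2 - n.
  case: ltnP => [lt|le]; first by rewrite modn_small.
  by rewrite -[in LHS](subnK le) modnDr modn_small //; lia.
rewrite mod1 mod2 /block_pattern; move: (n %% 3) n3 n_ge nE {mod1 mod2} => b.
case: b => [|[|[|//]]] _ n_ge nE; rewrite ?muln0 ?subn0 ?ltn0 /=;
  by apply/andP; split; do ?case: ifP; lia.
Qed.

Lemma exists_notin (C : choiceType) (A : {fset C}) (s : seq C) :
  size s < #|` A| -> exists c, (c \in A) && (c \notin s).
Proof.
move=> ltsA; have := size_filter_notin s (fset_uniq A).
case E : [seq c <- A | c \notin s] => [|c t]; first by rewrite leqNgt ltsA.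
by exists c; have := mem_head c t; rewrite -E mem_filter andbC.
Qed.

(** * Coloring a cycle so that vertices at distance at most two differ *)

Section CycleColoring.
Variables (G : sgraph) (C : choiceType) (L : G -> {fset C}) (n : nat) (f : nat -> G).
Hypotheses (n_gt2 : 2 < n) (degree2 : forall x : G, #|neighbors x| = 2)
  (f_inj : {in gtn n &, injective f})
  (f_surj : forall x, exists i, (i < n) && (f i == x))
  (fN : forall i, i < n ->
    neighbors (f i) = [set f (i.+1 %% n); f ((i + n.-1) %% n)]).

(** The distance-two condition gives the two neighbors of each vertex different colors, each then of
    multiplicity one. *)
Lemma color_along_cycle (c : nat -> C) :
    (forall i, i < n -> c i \in L (f i)) ->
    (forall i, i < n -> (c i != c (i.+1 %% n)) && (c i != c (i.+2 %% n))) ->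
  exists phi, odd_coloring phi /\ forall v, phi v \in L v.
Proof.
move=> cL c_neq; pose idx x := xchoose (f_surj x).
have idxP x : (idx x < n) && (f (idx x) == x) := xchooseP (f_surj x).
have n_gt0 : 0 < n by lia.
have idxK i : i < n -> idx (f i) = i.
  by move=> ltin; have /andP [? /eqP] := idxP (f i); apply: f_inj.
have prevK i : i < n -> ((i + n.-1) %% n).+1 = i %[mod n].
  by move=> ltin; rewrite -addn1 modnDml -addnA addn1 (ltn_predK n_gt0) modnDr.
have prev2K i : i < n -> ((i + n.-1) %% n).+2 = i.+1 %[mod n].
  by move=> /prevK eq_i; rewrite -addn1 -modnDml eq_i modnDml addn1.
exists (c \o idx); split=> [|v]; last first.
  by have /andP [? /eqP {2}<-] := idxP v; apply: cL.
have nbr i : i < n -> c i != c ((i + n.-1) %% n).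
  move=> ltin; have /c_neq := ltn_pmod (i + n.-1) n_gt0.
  by rewrite prevK // (modn_small ltin) eq_sym => /andP[].
split=> [x y|x _].
  have /andP [ltin /eqP <-] := idxP x; move: (idx x) ltin => i ltin xy.
  have : y \in neighbors (f i) by rewrite inE.
  rewrite fN // !inE => /orP [] /eqP -> /=; rewrite !idxK ?ltn_pmod //; apply/eqP.
    by case/andP: (c_neq i ltin).
  exact: nbr.
have /andP [ltin /eqP <-] := idxP x; move: (idx x) ltin => i ltin.
apply/(happyP (c \o idx)); apply: (@two_colors_happy _ _ _ _ (f ((i + n.-1) %% n))
    (f (i.+1 %% n))); rewrite ?degree2 ?fN ?inE ?eqxx ?orbT //=.
(* The inequality needed at [i] is the distance-two condition at its predecessor. *)
rewrite !idxK ?ltn_pmod // -prev2K //.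
by have /c_neq/andP[] := ltn_pmod (i + n.-1) n_gt0.
Qed.

Lemma cycle5_isomorphic : n = 5 -> isomorphic G C5.
Proof.
move=> n5; pose h (i : 'I_5) := f i.
have h_inj : injective h.
  by move=> i j /f_inj; rewrite !inE n5 !ltn_ord => /(_ isT isT)/val_inj.
have h_surj x : exists i, h i == x.
  by have [i] := f_surj x; rewrite n5 => /andP [lti fi]; exists (Ordinal lti).
pose g x := xchoose (h_surj x).
have gK : cancel g h by move=> x; apply/eqP/(xchooseP (h_surj x)).
exists g; first by exists h => // i; apply: h_inj; rewrite gK.
move=> x y; rewrite -[x in RHS]gK -[y in RHS]gK; move: (g x) (g y) => i j.
have -> : adj (h i) (h j) = (h j \in neighbors (h i)) by rewrite inE.
have h_eq k : k < 5 -> (h j == f k) = (j == k :> nat).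
  by move=> ltk; rewrite /h; apply/eqP/eqP => [/f_inj|-> //]; rewrite !inE n5 ltn_ord ltk; apply.
rewrite /h fN ?n5 // !inE !h_eq ?ltn_pmod //= /cycle_adj -!val_eqE /=.
by case: i => [[|[|[|[|[|]]]]]] //; case: j {h_eq} => [[|[|[|[|[|]]]]]].
Qed.

Hypothesis card4 : forall v, #|` L v| = 4.

Lemma color_cycle_same_lists : (forall u v, L u = L v) -> n != 5 ->
  exists phi, odd_coloring phi /\ forall v, phi v \in L v.
Proof.
move=> same n_neq5; have [x0 _] : exists c, (c \in L (f 0)) && (c \notin [::]).
  by apply: exists_notin; rewrite card4.
pose s : seq C := L (f 0); have size_s : size s = 4 := card4 (f 0).
apply: (@color_along_cycle (fun i => nth x0 s (block_pattern n i))) => i ltin.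
  by rewrite (same _ (f 0)) mem_nth // size_s block_pattern_lt.
by rewrite !nth_uniq ?fset_uniq ?size_s ?block_pattern_lt ?block_pattern_neq.
Qed.

(* Start with a color of f 1 that is useless for f 0 and color f 2, ..., f n.-1 greedily:
   f 0 comes last and sees only three dangerous colors. *)
Lemma color_cycle_distinct_lists : L (f 0) != L (f 1) ->
  exists phi, odd_coloring phi /\ forall v, phi v \in L v.
Proof.
move=> L01; have [c1 c1L c1L0] : exists2 c, c \in L (f 1) & c \notin L (f 0).
  apply/fsubsetPn; apply: contraNN L01 => sub.
  by rewrite eq_sym eqEfcard sub !card4.
(* The color [c1] is avoided throughout because [f n.-1] is two steps from [f 1]. *)
have pickP k (p : C * C) : exists c, (c \in L (f k)) && (c \notin [:: p.1; p.2; c1]).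
  by apply: exists_notin; rewrite card4.
(* [state i] holds the pair [d i], [d i.+1]. Both start as [c1]: [d 1] is the color of [f 1], and
   [d 0] is a placeholder superseded by [c0]. *)
pose state i := iteri i (fun k p => (p.2, xchoose (pickP k.+2 p))) (c1, c1).
pose d i := (state i).1.
have dP i : [/\ d i.+2 \in L (f i.+2), d i.+2 != d i, d i.+2 != d i.+1 & d i.+2 != c1].
  have := xchooseP (pickP i.+2 (state i)).
  by rewrite !inE !negb_or => /and4P [].
(* Of the vertices within distance two of [f 0], [f 1] is harmless because [c1] is not in [L (f 0)];
   three colors remain to avoid in a list of four. *)
have [c0 /andP [c0L]] : exists c, (c \in L (f 0)) && (c \notin [:: d 2; d n.-1; d n.-2]).
  by apply: exists_notin; rewrite card4.
rewrite !inE !negb_or => /and3P [c0_2 c0_1' c0_2'].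
have c01 : c0 != c1 by apply: contraNneq c1L0 => <-.
apply: (@color_along_cycle (fun i => if i is 0 then c0 else d i)) => [[|[|i]] ltin //|].
  by case: (dP i).
case=> [|i] ltin; first by rewrite !modn_small //= ?c01 ?c0_2 //; lia.
apply/andP; split.
  have [lt|ge] := ltnP i.+2 n.
    by rewrite modn_small // eq_sym; case: (dP i).
  have -> : i.+2 = n by lia.
  by rewrite modnn eq_sym (_ : i.+1 = n.-1) //; lia.
have [lt|ge] := ltnP i.+3 n.
  by rewrite modn_small // eq_sym; case: (dP i.+1).
have [ge'|lt'] := leqP n i.+2; last first.
  have -> : i.+3 = n by lia.
  by rewrite modnn eq_sym (_ : i.+1 = n.-2) //; lia.
have -> : i.+3 = 1 + n by lia.
rewrite modnDr modn_small; last by lia.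
by case: i {ltin ge} ge' => [|i _]; [lia|case: (dP i)].
Qed.

End CycleColoring.

Theorem theorem4 (G : sgraph) (Delta : nat) (C : choiceType) (L : G -> {fset C})
    (G_connected : connected_graph G)
    (G_max_degree : max_degree G = Delta)
    (Delta_ge1 : 1 <= Delta)
    (card_L : forall v : G, #|` L v| = 2 * Delta) :
  ~ (isomorphic G C5 /\ forall u v : G, L u = L v) ->
  exists phi : G -> C, odd_coloring phi /\ forall v : G, phi v \in L v.
Proof.
case: G_connected => /card_gt0P [r _] conn not_exceptional.
have degree_le (x : G) : #|neighbors x| <= Delta.
  by rewrite -G_max_degree; exact: (@leq_bigmax _ (fun y : G => #|neighbors y|)).
apply: NNPP => uncolorable.
have degreeE (x : G) := degree_eq conn degree_le Delta_ge1 card_L uncolorable x.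
have Delta2 : Delta = 2.
  have := Delta_neq1 conn degree_le Delta_ge1 card_L uncolorable r.
  by have := Delta_le2 conn degree_le Delta_ge1 card_L uncolorable r; lia.
have degree2 (x : G) : #|neighbors x| = 2 by rewrite degreeE.
have card4 v : #|` L v| = 4 by rewrite card_L Delta2.
apply: uncolorable; have [/forallP same|/forallPn [z z_diff]] :=
    boolP [forall z, L z == L r].
  have [b] : exists b, b \in neighbors r by apply/card_gt0P; rewrite degree2.
  rewrite inE => /(cycle_walk conn degree2) [n [f [[n_gt2 _] f_inj f_surj fN]]].
  have sameL u v : L u = L v by rewrite (eqP (same u)) (eqP (same v)).
  apply: (color_cycle_same_lists n_gt2 degree2 f_inj f_surj fN card4 sameL).
  apply/eqP => n5; apply: not_exceptional; split=> //.
  exact: (cycle5_isomorphic f_inj f_surj fN n5).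
(* A boundary edge of the set of vertices sharing the list of [r] joins two different lists; the
   walk is started along it. *)
have [|||a [b [aU bU ab]]] := @boundary_edge G [set x | L x == L r] r z.
- exact: conn.
- by rewrite inE.
- by rewrite inE.
have [n [f [[n_gt2 [f0 f1]] f_inj f_surj fN]]] := cycle_walk conn degree2 ab.
apply: (color_cycle_distinct_lists n_gt2 degree2 f_inj f_surj fN card4).
by move: aU bU; rewrite f0 f1 !inE => aU /eqP ->.
Qed.
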